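(* Let $X$ be a finite set and let $(x,y)\mapsto(\sigma_x(y),\tau_y(x))$ be a non-degenerate set-theoretic solution of the braid equation on $X$ (not necessarily involutive). Let $V=\mathbb{C}X$, and for $x\in X$ let $\mathbb{V}_x=\sum_{y\in X}e_{\sigma_x(y),y}$, $\mathbb{W}_x=\sum_{\eta\in X}e_{\tau_x(\eta),\eta}$, and $$F=\sum_{x\in X}e_{x,x}\otimes\mathbb{V}_x,\qquad \hat F=\sum_{y\in X}\mathbb{W}_y\otimes e_{y,y}\qquad\text{in }\mathrm{End}(V\otimes V).$$ For $\mathcal{T}\in\{F,\hat F\}$ put $\mathcal{T}_{12}=\mathcal{T}\otimes\mathrm{id}$ and $\mathcal{T}_{23}=\mathrm{id}\otimes\mathcal{T}$, and let $$F_{1,23}=\sum_{x,y,\eta\in X}e_{\eta,\eta}\otimes e_{\sigma_\eta(x),x}\otimes e_{\sigma_{\tau_x(\eta)}(y),y},\qquad F^*_{12,3}=\sum_{x,y,\eta\in X}e_{\eta,\eta}\otimes e_{x,x}\otimes e_{\sigma_\eta(\sigma_x(y)),y},$$ $$\hat F^*_{1,23}=\sum_{x,y,\eta\in X}e_{\tau_y(\tau_x(\eta)),\eta}\otimes e_{x,x}\otimes e_{y,y},\qquad \hat F_{12,3}=\sum_{x,y,\eta\in X}e_{\tau_{\sigma_x(y)}(\eta),\eta}\otimes e_{\tau_y(x),x}\otimes e_{y,y}.$$ Then $$F_{12}F^*_{12,3}=F_{23}F_{1,23},\qquad \hat F_{12}\hat F_{12,3}=\hat F_{23}\hat F^*_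{1,23}.$$
   Context: $V=\mathbb{C}X$ is the vector space with basis $\{e_x\}_{x\in X}$, and $e_{x,y}\in\mathrm{End}(V)$ is the matrix unit with $e_{x,y}e_w=\delta_{y,w}e_x$. A map $X\times X\to X\times X$, $(x,y)\mapsto(\sigma_x(y),\tau_y(x))$, is a set-theoretic solution of the braid equation if it satisfies $(\check s\times\mathrm{id})(\mathrm{id}\times\check s)(\check s\times\mathrm{id})=(\mathrm{id}\times\check s)(\check s\times\mathrm{id})(\mathrm{id}\times\check s)$ (with $\check s$ the map); equivalently, for all $\eta,x,y\in X$: $\sigma_\eta(\sigma_x(y))=\sigma_{\sigma_\eta(x)}(\sigma_{\tau_x(\eta)}(y))$, $\tau_y(\tau_x(\eta))=\tau_{\tau_y(x)}(\tau_{\sigma_x(y)}(\eta))$, and $\tau_{\sigma_{\tau_x(\eta)}(y)}(\sigma_\eta(x))=\sigma_{\tau_{\sigma_x(y)}(\eta)}(\tau_y(x))$. It is non-degenerate if all $\sigma_x$ and $\tau_y$ are bijections of $X$. *)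

(* Defs.v *)
From HB Require Import structures.
From mathcomp Require Import all_boot all_order all_algebra.
From mathcomp Require Import reals complex mxtens.

Set Implicit Arguments.
Unset Strict Implicit.
Unset Printing Implicit Defensive.

Import GRing.Theory.
Local Open Scope ring_scope.

Definition braid_map (X : Type) (sigma tau : X -> X -> X) (p : X * X) : X * X :=
  (sigma p.1 p.2, tau p.2 p.1).

Definition map12 (X : Type) (s : X * X -> X * X) (t : X * X * X) : X * X * X :=
  (s t.1, t.2).

Definition map23 (X : Type) (s : X * X -> X * X) (t : X * X * X) : X * X * X :=
  let p := s (t.1.2, t.2) in (t.1.1, p.1, p.2).

Definition braid_equation (X : Type) (s : X * X -> X * X) : Prop :=
  map12 s \o map23 s \o map12 s =1 map23 s \o map12 s \o map23 s.

Definition braid_solution (X : Type) (sigma tau : X -> X -> X) : Prop :=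
  braid_equation (braid_map sigma tau).

Definition non_degenerate (X : Type) (sigma tau : X -> X -> X) : Prop :=
  (forall x, bijective (sigma x)) /\ (forall y, bijective (tau y)).

Lemma braid_solutionE (X : Type) (sigma tau : X -> X -> X) :
  braid_solution sigma tau <->
  forall eta x y,
    [/\ sigma eta (sigma x y) = sigma (sigma eta x) (sigma (tau x eta) y),
        tau y (tau x eta) = tau (tau y x) (tau (sigma x y) eta)
      & tau (sigma (tau x eta) y) (sigma eta x) =
        sigma (tau (sigma x y) eta) (tau y x)].
Proof.
split=> [h eta x y | h [[eta x] y]].
  by case: (h (eta, x, y)) => e1 e2 e3; split.
by have [e1 e2 e3] := h eta x y; rewrite /map12 /map23 /braid_map /= e1 e2 e3.
Qed.

(* V = C X is identified with the column vectors 'cV[R[i]]_#|X| through the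
   enumeration of X, so that matrices act on the left and the product of
   endomorphisms is *m.  The tensor product of endomorphisms is the Kronecker
   product *t, and V (x) V (x) V is bracketed to the left. *)

Notation EndV R X := 'M[R[i]]_#|X|.
Notation EndVV R X := 'M[R[i]]_(#|X| * #|X|).
Notation EndVVV R X := 'M[R[i]]_(#|X| * #|X| * #|X|).

Definition basis_vec (R : realType) (X : finType) (x : X) : 'cV[R[i]]_#|X| :=
  delta_mx (enum_rank x) 0.

Definition munit (R : realType) (X : finType) (x y : X) : EndV R X :=
  delta_mx (enum_rank x) (enum_rank y).

Lemma munit_basis (R : realType) (X : finType) (x y w : X) :
  munit R x y *m basis_vec R w = (y == w)%:R *: basis_vec R x.
Proof.
rewrite /munit /basis_vec mul_delta_mx_cond (inj_eq enum_rank_inj).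
by rewrite scaler_nat.
Qed.

Definition VV (R : realType) (X : finType) (sigma : X -> X -> X) (x : X) :
  EndV R X := \sum_(y : X) munit R (sigma x y) y.

Definition WW (R : realType) (X : finType) (tau : X -> X -> X) (x : X) :
  EndV R X := \sum_(eta : X) munit R (tau x eta) eta.

Definition F (R : realType) (X : finType) (sigma : X -> X -> X) : EndVV R X :=
  \sum_(x : X) munit R x x *t VV R sigma x.

Definition Fhat (R : realType) (X : finType) (tau : X -> X -> X) : EndVV R X :=
  \sum_(y : X) WW R tau y *t munit R y y.

Definition leg12 (R : realType) (X : finType) (T : EndVV R X) : EndVVV R X :=
  T *t (1%:M : EndV R X).

(* The cast along mulnA is the reassociation
   V (x) (V (x) V) = (V (x) V) (x) V; see leg23_tens. *)
Definition leg23 (R : realType) (X : finType) (T : EndVV R X) : EndVVV R X :=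
  castmx (mulnA _ _ _, mulnA _ _ _) ((1%:M : EndV R X) *t T).

Lemma leg23_tens (R : realType) (X : finType) (A B : EndV R X) :
  leg23 (A *t B) = (1%:M : EndV R X) *t A *t B.
Proof.
apply/matrixP=> i j; rewrite castmxE.
case: (mxtens_indexP i) => i12 i3; case: (mxtens_indexP i12) => i1 i2.
case: (mxtens_indexP j) => j12 j3; case: (mxtens_indexP j12) => j1 j2.
have assoc (a b c : 'I_#|X|) :
    cast_ord (esym (mulnA _ _ _)) (mxtens_index (mxtens_index (a, b), c)) =
    mxtens_index (a, mxtens_index (b, c)).
  by apply: val_inj; rewrite /= mulnDl mulnA addnA.
by rewrite !assoc !tensmxE mulrA.
Qed.

Definition F_1_23 (R : realType) (X : finType) (sigma tau : X -> X -> X) :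
  EndVVV R X :=
  \sum_(x : X) \sum_(y : X) \sum_(eta : X)
    munit R eta eta *t munit R (sigma eta x) x
      *t munit R (sigma (tau x eta) y) y.

Definition Fstar_12_3 (R : realType) (X : finType) (sigma : X -> X -> X) :
  EndVVV R X :=
  \sum_(x : X) \sum_(y : X) \sum_(eta : X)
    munit R eta eta *t munit R x x *t munit R (sigma eta (sigma x y)) y.

Definition Fhatstar_1_23 (R : realType) (X : finType) (tau : X -> X -> X) :
  EndVVV R X :=
  \sum_(x : X) \sum_(y : X) \sum_(eta : X)
    munit R (tau y (tau x eta)) eta *t munit R x x *t munit R y y.

Definition Fhat_12_3 (R : realType) (X : finType) (sigma tau : X -> X -> X) :
  EndVVV R X :=
  \sum_(x : X) \sum_(y : X) \sum_(eta : X)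
    munit R (tau (sigma x y) eta) eta *t munit R (tau y x) x *t munit R y y.

(* Main.v *)
Require Import Defs.
From mathcomp Require Import all_boot all_order all_algebra.
From mathcomp Require Import reals complex mxtens.

Local Open Scope ring_scope.

(** Every operator in the statement is the linearization of a self-map of
    X * X * X: it permutes or collapses the basis vectors
    [e_eta (x) e_x (x) e_y] without producing coefficients.  Linearization turns
    composition of maps into the product of matrices ([lin3M]), so each identity
    between operators reduces to an identity between maps on triples.  With
    (eta, x, y) as argument, the first one compares
    - [(eta, sigma_eta x, sigma_eta (sigma_x y))] and
    - [(eta, sigma_eta x, sigma_(sigma_eta x) (sigma_(tau_x eta) y))],
    which is the first component of the braid equation; the second one compares
    - [(tau_(tau_y x) (tau_(sigma_x y) eta), tau_y x, y)] and
    - [(tau_y (tau_x eta), tau_y x, y)],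
    which is the second component.  The lemmas [leg12_F], [leg23_F],
    [leg12_Fhat] and [leg23_Fhat] recognize the legs of the twists as
    linearizations; for the other four operators this is their definition, up to
    the order of summation ([lin3E]). *)

Section TensorSums.
Variables (K : pzRingType) (m n p q : nat) (I : finType).

Lemma tensmx_suml (A : I -> 'M[K]_(m, n)) (B : 'M[K]_(p, q)) :
  (\sum_i A i) *t B = \sum_i A i *t B.
Proof.
apply/matrixP=> i j; rewrite summxE mxE summxE GRing.mulr_suml.
by apply: eq_bigr => k _; rewrite mxE.
Qed.

Lemma tensmx_sumr (A : 'M[K]_(m, n)) (B : I -> 'M[K]_(p, q)) :
  A *t (\sum_i B i) = \sum_i A *t B i.
Proof.
apply/matrixP=> i j; rewrite summxE mxE summxE GRing.mulr_sumr.
by apply: eq_bigr => k _; rewrite mxE.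
Qed.

End TensorSums.

Section Linearization.
Variables (R : realType) (X : finType).
Implicit Types (p q r s t : X * X * X) (f g : X * X * X -> X * X * X).

Lemma munitM (a b c d : X) :
  munit R a b *m munit R c d = if b == c then munit R a d else 0.
Proof.
by rewrite /munit mul_delta_mx_cond (inj_eq enum_rank_inj); case: (b == c).
Qed.

Lemma sum_munit_diag : \sum_x munit R x x = 1%:M :> 'M_#|X|.
Proof.
rewrite [RHS]mx1_sum_delta [RHS](reindex (@enum_rank X)) //.
exact/onW_bij/enum_rank_bij.
Qed.

Definition munit3 p q : EndVVV R X :=
  munit R p.1.1 q.1.1 *t munit R p.1.2 q.1.2 *t munit R p.2 q.2.

Lemma munit3M p q r s :
  munit3 p q *m munit3 r s = if q == r then munit3 p s else 0.
Proof.
case: p q r s => [[p1 p2] p3] [[q1 q2] q3] [[r1 r2] r3] [[s1 s2] s3].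
rewrite /munit3 !tensmx_mul /= !munitM !xpair_eqE.
case: (q1 == r1); last by rewrite !tens0mx.
case: (q2 == r2); last by rewrite tensmx0 tens0mx.
by case: (q3 == r3); rewrite ?tensmx0.
Qed.

Definition lin3 f : EndVVV R X := \sum_t munit3 (f t) t.

Lemma eq_lin3 f g : f =1 g -> lin3 f = lin3 g.
Proof. by move=> fg; apply: eq_bigr => t _; rewrite fg. Qed.

Lemma lin3M f g : lin3 f *m lin3 g = lin3 (f \o g).
Proof.
rewrite /lin3 mulmx_sumr; apply: eq_bigr => t _.
rewrite mulmx_suml (bigD1 (g t)) //= munit3M eqxx big1 ?GRing.addr0 // => s.
by rewrite munit3M => /negPf->.
Qed.

Lemma lin3E f :
  \sum_x \sum_y \sum_eta munit3 (f (eta, x, y)) (eta, x, y) = lin3 f.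
Proof.
rewrite pair_bigA exchange_big /= pair_bigA.
rewrite (reindex (fun t => (t.1.1, (t.1.2, t.2)))) /=.
  by apply: eq_bigr => -[[]].
by exists (fun u => (u.1, u.2.1, u.2.2)) => [[[]]|[? []]].
Qed.

Lemma leg23_sum (I : finType) (T : I -> EndVV R X) :
  leg23 (\sum_i T i) = \sum_i leg23 (T i).
Proof.
rewrite /leg23 tensmx_sumr; apply/matrixP=> i j.
by rewrite castmxE !summxE; apply: eq_bigr => k _; rewrite castmxE.
Qed.

Variables (sigma tau : X -> X -> X).

(** On the legs the identity factor is expanded as the sum of the diagonal
    matrix units, so that it contributes an index of summation and leaves its
    basis vector fixed. *)
Lemma leg12_F :
  leg12 (F R sigma) = lin3 (fun t => (t.1.1, sigma t.1.1 t.1.2, t.2)).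
Proof.
rewrite -lin3E /leg12 /F tensmx_suml.
under eq_bigr => a _.
  rewrite /VV tensmx_sumr tensmx_suml.
  under eq_bigr => b _ do rewrite -sum_munit_diag tensmx_sumr.
  over.
by rewrite exchange_big; apply: eq_bigr => b _; rewrite exchange_big.
Qed.

Lemma leg12_Fhat :
  leg12 (Fhat R tau) = lin3 (fun t => (tau t.1.2 t.1.1, t.1.2, t.2)).
Proof.
rewrite -lin3E /leg12 /Fhat tensmx_suml.
under eq_bigr => b _.
  rewrite /WW !tensmx_suml.
  under eq_bigr => a _ do rewrite -sum_munit_diag tensmx_sumr.
  over.
by apply: eq_bigr => b _; rewrite exchange_big.
Qed.

Lemma leg23_F :
  leg23 (F R sigma) = lin3 (fun t => (t.1.1, t.1.2, sigma t.1.2 t.2)).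
Proof.
rewrite -lin3E leg23_sum; apply: eq_bigr => b _.
rewrite /VV tensmx_sumr leg23_sum; apply: eq_bigr => c _.
by rewrite leg23_tens -sum_munit_diag !tensmx_suml.
Qed.

Lemma leg23_Fhat :
  leg23 (Fhat R tau) = lin3 (fun t => (t.1.1, tau t.2 t.1.2, t.2)).
Proof.
rewrite -lin3E leg23_sum exchange_big; apply: eq_bigr => c _.
rewrite /WW tensmx_suml leg23_sum; apply: eq_bigr => b _.
by rewrite leg23_tens -sum_munit_diag !tensmx_suml.
Qed.

Lemma F_1_23E :
  F_1_23 R sigma tau =
  lin3 (fun t => (t.1.1, sigma t.1.1 t.1.2, sigma (tau t.1.2 t.1.1) t.2)).
Proof. by rewrite -lin3E. Qed.

Lemma Fstar_12_3E :
  Fstar_12_3 R sigma =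
  lin3 (fun t => (t.1.1, t.1.2, sigma t.1.1 (sigma t.1.2 t.2))).
Proof. by rewrite -lin3E. Qed.

Lemma Fhatstar_1_23E :
  Fhatstar_1_23 R tau =
  lin3 (fun t => (tau t.2 (tau t.1.2 t.1.1), t.1.2, t.2)).
Proof. by rewrite -lin3E. Qed.

Lemma Fhat_12_3E :
  Fhat_12_3 R sigma tau =
  lin3 (fun t => (tau (sigma t.1.2 t.2) t.1.1, tau t.2 t.1.2, t.2)).
Proof. by rewrite -lin3E. Qed.

End Linearization.

Theorem proposition4p6 (R : realType) (X : finType) (sigma tau : X -> X -> X)
    (hsol : braid_solution sigma tau) (hnd : non_degenerate sigma tau) :
  leg12 (F R sigma) *m Fstar_12_3 R sigma =
    leg23 (F R sigma) *m F_1_23 R sigma tau /\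
  leg12 (Fhat R tau) *m Fhat_12_3 R sigma tau =
    leg23 (Fhat R tau) *m Fhatstar_1_23 R tau.
Proof.
move/braid_solutionE: hsol => braid; split.
- rewrite leg12_F leg23_F Fstar_12_3E F_1_23E !lin3M.
  apply: eq_lin3 => -[[eta x] y] /=.
  by have [-> _ _] := braid eta x y.
- rewrite leg12_Fhat leg23_Fhat Fhat_12_3E Fhatstar_1_23E !lin3M.
  apply: eq_lin3 => -[[eta x] y] /=.
  by have [_ -> _] := braid eta x y.
Qed.
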